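(* Let $\beta_1>1$ be a Pisot number of degree at least $3$, and let $\beta_2>1$ be a real number such that $\beta_1$ and $\beta_2$ are multiplicatively independent. Then there is no Borel probability measure $\mu$ on $[0,1)$ that is invariant under both $T_{\beta_1}$ and $T_{\beta_2}$, ergodic under $T_{\beta_2}$, and of positive entropy under $T_{\beta_2}$.
   Context: For real $\beta>1$, the $\beta$-transformation $T_\beta:[0,1)\to[0,1)$ is $T_\beta(x)=\beta x \pmod 1$, i.e. $T_\beta(x)=\beta x-\lfloor \beta x\rfloor$. A Pisot number is a real algebraic integer greater than $1$ all of whose other algebraic conjugates have modulus strictly less than $1$; its degree is the degree of its minimal polynomial. Two positive reals $a,b$ (here both $>1$) are multiplicatively independent if $\log a/\log b\notin\mathbb{Q}$. Entropy means Kolmogorov–Sinai (measure-theoretic) entropy. The Rényi–Parry measure $\nu_\beta$ is the unique $T_\beta$-invariant Borel probability measure on $[0,1)$ equivalent to Lebesgue measure. A known theorem of Hochman and Shmerkin (Equidistribution from fractal measures, Invent. Math. 2015, Corollary 1.11), which may be used, states: if $\beta_1,\beta_2>1$ are multiplicatively independent with $\beta_1$ a Pisot number, $\mu$ is jointly invariant under $T_{\beta_1}$ and $T_{\beta_2}$, and all ergodic components of $\mu$ under $T_{\beta_2}$ have positive entropy, then $\mu$ is the common Rényi–Parry measure for $\beta_1$ and $\beta_2$. *)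

(* Defs.v *)
From HB Require Import structures.
From mathcomp Require Import all_boot all_order all_algebra.
From mathcomp Require Import all_classical all_reals all_analysis.
From mathcomp Require Import complex.

Set Implicit Arguments.
Unset Strict Implicit.
Unset Printing Implicit Defensive.

Import Order.TTheory GRing.Theory Num.Theory.
Import numFieldNormedType.Exports.

Local Open Scope classical_set_scope.
Local Open Scope ring_scope.

Definition algebraic_integer (R : realType) (x : R) : Prop :=
  integralOver (intr : int -> R) x.

Definition is_minimal_polynomial (R : realType) (p : {poly rat}) (x : R) : Prop :=
  [/\ p \is monic, irreducible_poly p & root (map_poly ratr p) x].

(* The order on R[i] is partial: `|z| < 1 says that the (real) modulus of z is
   less than 1. *)
Definition pisot (R : realType) (beta : R) : Prop :=
  [/\ 1 < beta,
      algebraic_integer beta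
    & forall p : {poly rat}, is_minimal_polynomial p beta ->
      forall z : R[i], root (map_poly ratr p) z ->
        z != real_complex R beta -> `|z| < 1].

Definition algebraic_degree (R : realType) (x : R) (n : nat) : Prop :=
  exists2 p : {poly rat}, is_minimal_polynomial p x & (size p).-1 = n.

Definition multiplicatively_independent (R : realType) (a b : R) : Prop :=
  irrational (ln a / ln b).

Record Ico01 (R : realType) :=
  MkIco01 { Ico01_val :> R; Ico01_valP : 0 <= Ico01_val < 1 }.

Section Ico01_instances.
Context {R : realType}.

HB.instance Definition _ := [isSub for @Ico01_val R].
HB.instance Definition _ := [Choice of Ico01 R by <:].

Fact zero_in_Ico01 : 0 <= (0 : R) < 1.
Proof. by rewrite lexx ltr01. Qed.

HB.instance Definition _ := isPointed.Build (Ico01 R) (MkIco01 zero_in_Ico01).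

(* The traces on [0, 1) of the Borel sets of R. *)
HB.instance Definition _ := Measurable.copy (Ico01 R)
  (g_sigma_algebra_preimageType (@Ico01_val R : Ico01 R -> measurableTypeR R)).

End Ico01_instances.

Fact beta_transformation_subproof (R : realType) (beta x : R) :
  0 <= beta * x - (Num.floor (beta * x))%:~R < 1.
Proof.
have /andP[h1 h2] := Num.Theory.floor_itv (beta * x).
by rewrite subr_ge0 h1 ltrBlDl -[X in _ + X]/(1%:~R) -intrD.
Qed.

Definition beta_transformation (R : realType) (beta : R) (x : Ico01 R) : Ico01 R :=
  MkIco01 (beta_transformation_subproof beta (Ico01_val x)).

Section ergodic_theory.
Context {d : measure_display} {X : measurableType d} {R : realType}.
Implicit Types (mu : {measure set X -> \bar R}) (T : X -> X).

Definition invariant_measure mu T : Prop :=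
  forall A, measurable A -> mu (T @^-1` A) = mu A.

Definition ergodic_measure mu T : Prop :=
  forall A, measurable A -> T @^-1` A = A -> mu A = 0%E \/ mu A = 1%E.

(* A finite partition of X is given by its labelling xi : X -> J, the cells
   being the fibres of xi (empty cells contribute 0 to the entropy). *)
Definition measurable_partition (J : finType) (xi : X -> J) : Prop :=
  forall j, measurable (xi @^-1` [set j]).

(* [ln 0 = 0], so that null cells contribute 0. *)
Definition partition_entropy mu (J : finType) (xi : X -> J) : R :=
  - \sum_(j : J) fine (mu (xi @^-1` [set j])) * ln (fine (mu (xi @^-1` [set j]))).

(* The labelling of the join of the partitions T^-i xi, 0 <= i < n. *)
Definition join_partition T (J : finType) (xi : X -> J) (n : nat) :
    X -> {ffun 'I_n -> J} :=
  fun x => [ffun i : 'I_n => xi (iter i T x)].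

(* The limit exists, by subadditivity, when mu is a T-invariant probability. *)
Definition entropy_of_partition mu T (J : finType) (xi : X -> J) : R :=
  limn (fun n : nat => partition_entropy mu (join_partition T xi n) / n%:R).

Definition ks_entropy mu T : \bar R :=
  ereal_sup [set h | exists (m : nat) (xi : X -> 'I_m),
    measurable_partition xi /\ h = (entropy_of_partition mu T xi)%:E].

(* The measures k x are the ergodic components of mu: k is a version of the
   conditional probability of mu given the sigma-algebra of T-invariant sets. *)
Definition ergodic_decomposition mu T (k : R.-pker X ~> X) : Prop :=
  [/\ {ae mu, forall x, invariant_measure (k x) T /\ ergodic_measure (k x) T},
      forall x A, measurable A -> k (T x) A = k x A
    & forall A E, measurable A -> measurable E -> T @^-1` E = E ->
        mu (A `&` E) = (\int[mu]_(x in E) k x A)%E].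

End ergodic_theory.

Definition equivalent_to_lebesgue (R : realType)
    (mu : {measure set (Ico01 R) -> \bar R}) : Prop :=
  forall A : set (Ico01 R), measurable A ->
    mu A = 0%E <-> lebesgue_measure (@Ico01_val R @` A) = 0%E.

Definition is_renyi_parry_measure (R : realType) (beta : R)
    (mu : probability (Ico01 R) R) : Prop :=
  invariant_measure mu (beta_transformation beta) /\ equivalent_to_lebesgue mu.

(* M. Hochman and P. Shmerkin, Equidistribution from fractal measures,
   Invent. Math. 202 (2015), Corollary 1.11. *)
Definition hochman_shmerkin_corollary (R : realType) : Prop :=
  forall beta1 beta2 : R,
    pisot beta1 -> 1 < beta2 -> multiplicatively_independent beta1 beta2 ->
  forall mu : probability (Ico01 R) R,
    invariant_measure mu (beta_transformation beta1) ->
    invariant_measure mu (beta_transformation beta2) ->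
  forall k : R.-pker (Ico01 R) ~> (Ico01 R),
    ergodic_decomposition mu (beta_transformation beta2) k ->
    {ae mu, forall x, (0 < ks_entropy (k x) (beta_transformation beta2))%E} ->
  is_renyi_parry_measure beta1 mu /\ is_renyi_parry_measure beta2 mu.

(* Main.v *)
Require Import Defs.
From mathcomp Require Import all_boot all_order all_algebra.
From mathcomp Require Import all_classical all_reals all_analysis.
From mathcomp Require Import measurable_realfun.
From mathcomp Require Import ring lra zify.

Set Implicit Arguments.
Unset Strict Implicit.
Unset Printing Implicit Defensive.

Import Order.TTheory GRing.Theory Num.Theory.
Import numFieldNormedType.Exports.

Local Open Scope classical_set_scope.
Local Open Scope ring_scope.

(* The ergodic decomposition of an ergodic measure is constant, so by
   Hochman-Shmerkin mu is the Renyi-Parry measure of both numbers; call them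
   a < b.  Up to a scalar, the Renyi-Parry measure of b has the density
   sum_n b^-n 1_[0, T_b^n 1) of Parry.  It jumps at t by the sum of the b^-n
   with T_b^n 1 = t, and it tends to 1 at 1, so the scalars for a and b agree
   and both densities have the same jumps.
   The sum of all jumps forces the a-orbit of 1 to reach 0: otherwise it would
   be sum_n a^-n > sum_n b^-n.  So the jumps of a are distinct powers a^-i.
   If T_b 1 is nonzero and never recurs, its jump b^-1 is some a^-i; if it
   recurs but is not a fixed point, the jumps at T_b 1 and T_b^2 1 have
   quotient b.  Both make b a power of a, contradicting independence.  Hence
   T_b 1 is 0 or a fixed point, and counting the jumps again, either a and b are
   integers, or T_a^2 1 = 0 and b - a is an integer.  In all cases a and b are
   quadratic or rational. *)

(** * The beta-transformation as a map of the real line *)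

Section beta_map.
Variable R : realType.
Local Notation leb := (@lebesgue_measure R).

Lemma measurable_affine (b c : R) : measurable_fun [set: measurableTypeR R]
  ((fun x => b * x + c) : measurableTypeR R -> measurableTypeR R).
Proof.
apply: measurable_funD => //; apply: measurable_funM => //.
Qed.

(** Lebesgue measure is determined by its values on the intervals []x, y]], and [b] times its image
    under the affine map gives each of them the length [y - x]. *)
Lemma lebesgue_affine (b c : R) (A : set (measurableTypeR R)) : 0 < b ->
  measurable A -> leb ((fun x => b * x + c) @^-1` A) = (b^-1%:E * leb A)%E.
Proof.
move=> b0 mA.
pose f : measurableTypeR R -> measurableTypeR R := fun x => b * x + c.
have mf : measurable_fun [set: measurableTypeR R] f by exact: measurable_affine.
have b0' : 0 <= b by exact: ltW.
pose nu : {measure set (measurableTypeR R) -> \bar R} := pushforward leb f.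
pose mu : {measure set (measurableTypeR R) -> \bar R} :=
  mscale (NngNum b0') (nu mf).
rewrite [leb A](@lebesgue_measure_unique R mu) //.
  by rewrite /mu /= /mscale /= muleA -EFinM mulVf ?gt_eqF// mul1e.
move=> X [[x y] _ <-].
rewrite /mu /= /mscale /= /pushforward.
have -> : f @^-1` `]x, y]%classic = `](x - c) / b, (y - c) / b]%classic.
  apply/seteqP; split => z; rewrite /f /= !in_itv/= ltr_pdivrMr// ler_pdivlMr//;
    by rewrite ltrBlDr lerBrDr mulrC.
rewrite !lebesgue_measure_itv/= !lte_fin ltr_pM2r ?invr_gt0// ltrD2r.
case: ifP => // _; last by rewrite mule0.
rewrite -!EFinB -EFinM; congr EFin.
by field; rewrite gt_eqF.
Qed.

Definition fpart (y : R) : R := y - (Num.floor y)%:~R.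

Lemma fpart_itv y : 0 <= fpart y < 1.
Proof.
by rewrite subr_ge0 floor_le ltrBlDl -[X in _ + X]/(1%:~R) -intrD floorD1_gt.
Qed.

Lemma fpart_id y : 0 <= y < 1 -> fpart y = y.
Proof. by move=> y01; rewrite /fpart (@floor_def _ y 0) ?subr0. Qed.

Lemma fpartD1 y : fpart (y + 1) = fpart y.
Proof. by rewrite /fpart floorDrz ?rpred1// floor1 intrD; ring. Qed.

Lemma measurable_fpart : measurable_fun [set: measurableTypeR R]
  (fpart : measurableTypeR R -> measurableTypeR R).
Proof.
apply: measurable_funB => //.
apply: nondecreasing_measurable => // x y xy.
by rewrite ler_int; exact: le_floor.
Qed.

Lemma measurable_preimage_fpart A : measurable (A : set (measurableTypeR R)) ->
  measurable (fpart @^-1` A : set (measurableTypeR R)).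
Proof.
by move=> mA; rewrite -[_ @^-1` _]setTI; apply: measurable_fpart.
Qed.

(** Induction on [n]: the piece [[0, 1[], where [fpart] is the identity, is split off, and the rest
    is translated back by 1 using [fpartD1]. *)
Lemma lebesgue_fpart (A : set (measurableTypeR R)) (n : nat) (u : R) :
  measurable A -> 0 <= u <= 1 ->
  leb ((fpart @^-1` A) `&` `[0, n%:R + u[%classic) =
  (n%:R%:E * leb (A `&` `[0%R, 1%R[%classic) + leb (A `&` `[0%R, u[%classic))%E.
Proof.
move=> mA /andP[u0 u1].
have mP := measurable_preimage_fpart mA.
elim: n => [|n IHn].
  rewrite mul0e !add0r; congr leb.
  apply/seteqP; split => x /=; rewrite in_itv/= => -[+ /andP[x0 xu]];
    by rewrite fpart_id ?x0 ?(lt_le_trans xu)// => ?; split => //; rewrite in_itv/= x0.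
rewrite -[n.+1%:R]natr1 (_ : n%:R + 1 + u = 1 + (n%:R + u)); last by ring.
set v := n%:R + u in IHn *.
have v0 : 0 <= v by rewrite addr_ge0.
rewrite (_ : _ `&` _ = (fpart @^-1` A `&` `[0, 1[%classic) `|`
    (fpart @^-1` A `&` `[1, 1 + v[%classic)); last first.
  rewrite -setIUr; congr (_ `&` _); apply/seteqP; split => x /=; rewrite !in_itv/=.
    by case: (ltP x 1) => x1 /andP[x0 xv]; [left; rewrite x0|right].
  by case=> /andP[x0 x1]; apply/andP; split => //; lra.
rewrite measureU/=; [|exact: measurableI|exact: measurableI|]; last first.
  rewrite -subset0 => x [] [_ +] [_] /=; rewrite !in_itv/= => /andP[_ x1] /andP[x1' _].
  by have := lt_le_trans x1 x1'; rewrite ltxx.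
have -> : fpart @^-1` A `&` `[0, 1[%classic = A `&` `[0, 1[%classic.
  by apply/seteqP; split => x [+ x01]; have := x01; rewrite /= in_itv/= => ?; rewrite fpart_id.
have -> : leb (fpart @^-1` A `&` `[1, 1 + v[%classic) =
  leb (fpart @^-1` A `&` `[0, v[%classic).
  rewrite -[LHS]mul1e -[X in X%:E]invr1 -(lebesgue_affine 1) ?ltr01//; last exact: measurableI.
  congr leb; apply/seteqP; split => x /=; rewrite !in_itv/= mul1r fpartD1 => -[Ax /andP[h1 h2]];
   by split => //; apply/andP; split; lra.
rewrite IHn EFinD ge0_muleDl ?lee_fin ?ler0n//.
by rewrite mul1e addeA [X in (X + _)%E]addeC.
Qed.

(* beta_transformation extended to the whole line, with values in [0, 1). *)
Definition beta_map (b x : R) : R := fpart (b * x).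

Lemma measurable_beta_map b : measurable_fun [set: measurableTypeR R]
  (beta_map b : measurableTypeR R -> measurableTypeR R).
Proof.
apply: (measurableT_comp measurable_fpart).
by apply: measurable_funM => //.
Qed.

Lemma measurable_preimage_beta b A : measurable (A : set (measurableTypeR R)) ->
  measurable (beta_map b @^-1` A : set (measurableTypeR R)).
Proof.
by move=> mA; rewrite -[_ @^-1` _]setTI; apply: measurable_beta_map.
Qed.

(* [0, s[ consists of floor (b * s) intervals of length b^-1 mapped onto [0, 1[
   and of a remainder mapped onto [0, beta_map b s[. *)
Lemma lebesgue_preimage_beta b s (A : set (measurableTypeR R)) :
  0 < b -> 0 <= s -> measurable A ->
  leb ((beta_map b @^-1` A) `&` `[0, s[%classic) =
  (((Num.floor (b * s))%:~R / b)%:E * leb (A `&` `[0%R, 1%R[%classic) +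
   b^-1%:E * leb (A `&` `[0%R, beta_map b s[%classic))%E.
Proof.
move=> b0 s0 mA.
have mP := measurable_preimage_fpart mA.
have -> : (beta_map b @^-1` A) `&` `[0, s[%classic =
  (fun x => b * x + 0) @^-1` ((fpart @^-1` A) `&` `[0, b * s[%classic).
  apply/seteqP; split => x; rewrite /= /beta_map !in_itv/= addr0 pmulr_rge0// ltr_pM2l//.
rewrite lebesgue_affine//; last exact: measurableI.
have bs0 : (0 <= Num.floor (b * s))%R by rewrite floor_ge0 mulr_ge0// ltW.
have E : (Num.floor (b * s))%:~R = `|Num.floor (b * s)|%N%:R :> R.
  by rewrite -[in LHS](gez0_abs bs0).
have bsE : b * s = `|Num.floor (b * s)|%N%:R + beta_map b s.
  by rewrite -E /beta_map /fpart addrC subrK.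
have u01 : 0 <= beta_map b s <= 1.
  by have /andP[-> /ltW ->] := fpart_itv (b * s).
have := lebesgue_fpart `|Num.floor (b * s)|%N mA u01; rewrite -bsE => ->.
by rewrite ge0_muleDr ?mule_ge0 ?lee_fin// muleA -EFinM -E mulrC.
Qed.

(** Left rays form a pi-system that generates the Borel sets, and countably many of them cover the
    line. *)
Lemma finite_measure_eq_rays (m1 m2 : {measure set (measurableTypeR R) -> \bar R}) :
  (forall x, (m1 `]-oo, x[%classic < +oo)%E) ->
  (forall x, m1 `]-oo, x[%classic = m2 `]-oo, x[%classic) ->
  forall A, measurable A -> m1 A = m2 A.
Proof.
move=> m1oo m12 A mA.
apply: (@measure_unique _ R (measurableTypeR R) (@RGenInftyO.G R)
          (fun k : nat => `]-oo, k%:R[%classic)) => //.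
- exact: RGenInftyO.measurableE.
- move=> _ _ [x ->] [y ->]; exists (Num.min x y).
  by apply/seteqP; split => z; rewrite /= !in_itv/= lt_min; [case=> -> ->|move=> /andP].
- by move=> k; exists k%:R.
- apply/seteqP; split => // x _; exists (Num.bound `|x|) => //=.
  by rewrite in_itv/= (le_lt_trans (ler_norm x))// archi_boundP.
- by move=> _ [x ->].
Qed.

Lemma inv_pow_small (b e : R) : 1 < b -> 0 < e -> exists n, b ^- n < e.
Proof.
move=> b1 e0.
have b0 : 0 < b by rewrite (lt_trans _ b1).
have /(@cvg_expr R) : `|b^-1| < 1 by rewrite gtr0_norm ?invr_gt0// invf_lt1.
move=> /cvgrPdist_lt /(_ e e0) [n _ /(_ n (leqnn n))].
rewrite sub0r normrN normrX gtr0_norm ?invr_gt0// exprVn => h.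
by exists n.
Qed.

Lemma lebesgue_Ico_le (A : set (measurableTypeR R)) (s : R) : measurable A -> 0 <= s ->
  (leb (A `&` `[0%R, s[%classic) <= s%:E)%E.
Proof.
move=> mA s0; apply: (@le_trans _ _ (leb `[0, s[%classic)).
  by apply: le_measure; rewrite ?inE//=; exact: measurableI.
by rewrite lebesgue_measure_itv/= lte_fin; case: ifPn; rewrite ?oppr0 ?adde0 ?lee_fin.
Qed.

Lemma lebesgue_Ico_fin_num (A : set (measurableTypeR R)) (s : R) : measurable A -> 0 <= s ->
  leb (A `&` `[0, s[%classic) \is a fin_num.
Proof.
move=> mA s0; rewrite ge0_fin_numE//.
by rewrite (le_lt_trans (lebesgue_Ico_le mA s0)) ?ltry.
Qed.

(* By lebesgue_preimage_beta the bounded defect D t = leb (E `&` [0, t[) -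
   t * leb (E `&` [0, 1[) satisfies D (beta_map b t) = b * D t, so D = 0. *)
Lemma beta_invariant_equidistributed b (E : set (measurableTypeR R)) (s : R) : 1 < b ->
  measurable E -> beta_map b @^-1` E = E -> 0 <= s <= 1 ->
  leb (E `&` `[0, s[%classic) = (s%:E * leb (E `&` `[0%R, 1%R[%classic))%E.
Proof.
move=> b1 mE TE s01.
have b0 : 0 < b by rewrite (lt_trans _ b1).
pose len s := fine (leb (E `&` `[0, s[%classic)).
have lenE t : 0 <= t -> leb (E `&` `[0, t[%classic) = (len t)%:E.
  by move=> t0; rewrite fineK// lebesgue_Ico_fin_num.
pose D t := len t - t * len 1.
have DT t : 0 <= t <= 1 -> D t = b^-1 * D (beta_map b t).
  move=> /andP[t0 t1].
  have /andP[T0 T1] := fpart_itv (b * t).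
  have := lebesgue_preimage_beta b0 t0 mE; rewrite TE !lenE// -!EFinM -EFinD => -[lt].
  rewrite /D lt {3}(_ : t = b^-1 * ((Num.floor (b * t))%:~R + beta_map b t)).
    ring.
  by rewrite /beta_map /fpart addrC subrK mulKf ?gt_eqF.
have len01 t : 0 <= t <= 1 -> 0 <= len t <= 1.
  move=> /andP[t0 t1]; rewrite -!lee_fin -lenE// measure_ge0/=.
  by rewrite (le_trans (lebesgue_Ico_le mE t0)).
have Dle n t : 0 <= t <= 1 -> `|D t| <= b ^- n.
  elim: n t => [|n IHn] t t01.
    have /andP[? ?] := len01 _ t01; have /andP[? ?] := len01 1 (introT andP (conj ler01 (lexx _))).
    rewrite expr0 invr1 /D ler_norml; move: t01 => /andP[? ?].
    by apply/andP; split; nra.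
  rewrite DT// normrM gtr0_norm ?invr_gt0// exprS invfM ler_pM2l ?invr_gt0//.
  by apply: IHn; have /andP[-> /ltW ->] := fpart_itv (b * t).
have D0 : D s = 0.
  apply/eqP; rewrite -normr_le0 leNgt; apply/negP => /(inv_pow_small b1) [n].
  by rewrite ltNge Dle.
have /andP[s0 s1] := s01.
by rewrite !lenE// -EFinM; congr EFin; apply/eqP; rewrite -subr_eq0 -/(D s) D0.
Qed.

(** Equidistribution makes [E] independent of every ray under Lebesgue measure on [[0, 1[]. Hence
    [E] is independent of every Borel set, in particular of its own complement. *)
Lemma beta_map_ergodic b (E : set (measurableTypeR R)) : 1 < b ->
  measurable E -> beta_map b @^-1` E = E ->
  leb (E `&` `[0, 1[%classic) = 0%E \/ leb (~` E `&` `[0, 1[%classic) = 0%E.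
Proof.
move=> b1 mE TE.
have c_ge0 : 0 <= fine (leb (E `&` `[0, 1[%classic)) by rewrite fine_ge0.
have mI : measurable (`[0, 1[%classic : set (measurableTypeR R)) by [].
have mEI : measurable (E `&` `[0, 1[%classic) by exact: measurableI.
pose m1 : {measure set (measurableTypeR R) -> \bar R} := mrestr leb mEI.
pose m2 : {measure set (measurableTypeR R) -> \bar R} :=
  mscale (NngNum c_ge0) (mrestr leb mI).
have cE : ((NngNum c_ge0)%:num)%:E = leb (E `&` `[0, 1[%classic).
  by rewrite /= fineK// lebesgue_Ico_fin_num.
have m1E A : m1 A = leb (A `&` (E `&` `[0, 1[%classic)) by [].
have m2E A : m2 A = (leb (E `&` `[0%R, 1%R[%classic) * leb (A `&` `[0%R, 1%R[%classic))%E.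
  by rewrite -cE.
have ltE t : (leb (`]-oo, t[ `&` (E `&` `[0%R, 1%R[) ) < +oo)%E.
  rewrite (@le_lt_trans _ _ (leb (E `&` `[0, 1[%classic)))//.
    by apply: le_measure; rewrite ?inE//; exact: measurableI.
  by rewrite -ge0_fin_numE// lebesgue_Ico_fin_num.
have m12 : forall A, measurable A -> m1 A = m2 A.
  apply: finite_measure_eq_rays => x; rewrite m1E//.
  rewrite m2E.
  have minI (F : set R) :
      `]-oo, x[%classic `&` (F `&` `[0, 1[%classic) = F `&` `[0, Num.min x 1[%classic.
    rewrite setICA; congr (_ `&` _); apply/seteqP.
    by split => z; rewrite /= !in_itv/= lt_min; lra.
  have [x0|x0] := leP 0 x; last first.
    rewrite setIA (setIC _ E) -setIA.
    have -> : `]-oo, x[%classic `&` `[0, 1[%classic = set0 :> set R.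
      by rewrite -subset0 => z /=; rewrite !in_itv/=; lra.
    by rewrite setI0 measure0 mule0.
  have s01 : 0 <= Num.min x 1 <= 1 by rewrite le_min x0 ler01 ge_min lexx orbT.
  have /andP[s0 s1] := s01.
  rewrite -[X in (_ * leb (_ `&` X))%E]setTI !minI//.
  rewrite (beta_invariant_equidistributed b1)// muleC; congr (_ * _)%E.
  by rewrite setTI lebesgue_measure_itv/= lte_fin lt_neqAle s0 andbT; case: eqVneq => [<-|_]; rewrite ?oppr0 ?adde0.
have := m12 _ (measurableC mE).
rewrite m1E m2E setIA setICl set0I measure0 => /esym/eqP.
by rewrite mule_eq0 => /orP[] /eqP; [left|right].
Qed.

End beta_map.

(** * Sums of bounded sequences with weights b ^- n *)

Section weighted_sums.
Variable R : realType.

Definition bounded_seq (c : nat -> R) := exists M, forall n, `|c n| <= M.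

(** The series converges for [b > 1] and bounded [c]; otherwise [limn] may be a default value, hence
    the boundedness hypotheses below. *)
Definition wsum (b : R) (c : nat -> R) : R := limn (series (fun n => b ^- n * c n)).

Lemma bounded_seqD c e : bounded_seq c -> bounded_seq e -> bounded_seq (c \+ e).
Proof.
move=> [M cM] [K eK]; exists (M + K) => n /=.
by rewrite (le_trans (ler_normD _ _))// lerD.
Qed.

Lemma bounded_seqZ k c : bounded_seq c -> bounded_seq (k \*o c).
Proof.
by move=> [M cM]; exists (`|k| * M) => n /=; rewrite normrM ler_wpM2l.
Qed.

Lemma bounded_seq_shift N c : bounded_seq c -> bounded_seq (fun n => c (n + N)%N).
Proof. by move=> [M cM]; exists M. Qed.

Lemma bounded_seq01 c : (forall n, 0 <= c n <= 1) -> bounded_seq c.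
Proof. by move=> c01; exists 1 => n; have /andP[c0 c1] := c01 n; rewrite ger0_norm. Qed.

Variable b : R.
Hypothesis b1 : 1 < b.

Let b0 : 0 < b. Proof. by rewrite (lt_trans _ b1). Qed.

Let bn0 n : 0 < b ^- n. Proof. by rewrite invr_gt0 exprn_gt0. Qed.

Lemma cvg_wsum c : bounded_seq c -> cvgn (series (fun n => b ^- n * c n)).
Proof.
move=> [M cM]; apply: normed_cvg.
apply: (@series_le_cvg _ _ (geometric M b^-1)).
- by move=> n; exact: normr_ge0.
- by move=> n; rewrite /geometric/= mulr_ge0// ?exprn_ge0 ?invr_ge0 ?(ltW b0)// (le_trans _ (cM 0%N)).
- move=> n /=; rewrite normrM gtr0_norm// mulrC /geometric/= exprVn ler_pM2r//.
- by apply: is_cvg_geometric_series; rewrite gtr0_norm ?invr_gt0// invf_lt1.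
Qed.

Lemma wsumD c e : bounded_seq c -> bounded_seq e ->
  wsum b (c \+ e) = wsum b c + wsum b e.
Proof.
move=> bc be; rewrite /wsum -lim_seriesD; [|exact: cvg_wsum|exact: cvg_wsum].
congr (limn (series _)); apply/funext => n.
by rewrite /= mulrDr.
Qed.

Lemma wsumZ k c : bounded_seq c -> wsum b (k \*o c) = k * wsum b c.
Proof.
move=> bc; rewrite /wsum -[k * _]/(k *: _) -lim_seriesZ; last exact: cvg_wsum.
congr (limn (series _)); apply/funext => n.
by rewrite /= mulrCA.
Qed.

Lemma ler_wsum c e : bounded_seq c -> bounded_seq e -> (forall n, c n <= e n) ->
  wsum b c <= wsum b e.
Proof.
move=> bc be ce; apply: lim_series_le; [exact: cvg_wsum|exact: cvg_wsum|].
by move=> n; rewrite ler_pM2l.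
Qed.

Lemma wsum0 : wsum b (fun=> 0) = 0.
Proof.
rewrite /wsum (_ : series _ = cst 0) ?lim_cst//; apply/funext => n.
by rewrite /series /= big1// => i _; rewrite mulr0.
Qed.

Lemma wsum_ge0 c : bounded_seq c -> (forall n, 0 <= c n) -> 0 <= wsum b c.
Proof.
move=> bc c0; rewrite -wsum0; apply: ler_wsum => //.
by apply: bounded_seq01 => n; rewrite lexx ler01.
Qed.

Lemma wsum_recl c : bounded_seq c ->
  wsum b c = c 0%N + b^-1 * wsum b (fun n => c n.+1).
Proof.
move=> bc.
have bc1 : bounded_seq (fun n => c n.+1) by case: bc => M cM; exists M.
apply: cvg_lim => //; rewrite -cvg_shiftS.
rewrite [X in X @ _](_ : _ = (fun n =>
    c 0%N + b^-1 * series (fun n => b ^- n * c n.+1) n)).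
  by apply: cvgD; [exact: cvg_cst|apply: cvgM; [exact: cvg_cst|exact: cvg_wsum]].
apply/funext => n; rewrite /series /= big_nat_recl// expr0 invr1 mul1r.
congr (_ + _); rewrite big_distrr/=; apply: eq_bigr => i _.
by rewrite mulrA exprS invfM.
Qed.

Lemma wsum_split N c : bounded_seq c ->
  wsum b c = \sum_(i < N) b ^- i * c i + b ^- N * wsum b (fun n => c (n + N)%N).
Proof.
elim: N c => [|N IHN] c bc.
  rewrite big_ord0 add0r expr0 invr1 mul1r; congr wsum.
  by apply/funext => n; rewrite addn0.
rewrite wsum_recl// IHN; last by case: bc => M cM; exists M.
rewrite big_ord_recl expr0 invr1 mul1r mulrDr addrA; congr (_ + _ + _).
  by rewrite big_distrr/=; apply: eq_bigr => i _; rewrite mulrA exprS invfM.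
rewrite mulrA exprS invfM; congr (_ * wsum b _).
by apply/funext => n; rewrite addnS.
Qed.

Lemma wsum1 : wsum b (fun=> 1) = b / (b - 1).
Proof.
have /wsum_recl : bounded_seq (fun=> 1) by apply: bounded_seq01 => n; rewrite lexx ler01.
set w := wsum _ _ => wE.
have b10 : b - 1 != 0 by rewrite subr_eq0 gt_eqF.
apply: (mulIf b10); rewrite mulfVK// mulrBr mulr1 {1}wE mulrDl mul1r mulrAC.
by rewrite mulVf ?gt_eqF// mul1r addrK.
Qed.

(** The first [N] terms cancel, and each tail is [b ^- N] times a sum between 0 and
    [wsum b (fun=> 1)]. *)
Lemma wsum_tail_le N c e : (forall n, 0 <= c n <= 1) -> (forall n, 0 <= e n <= 1) ->
  (forall n, (n < N)%N -> c n = e n) ->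
  `|wsum b c - wsum b e| <= b ^- N * (b / (b - 1)).
Proof.
move=> c01 e01 ce.
have [bc be] := (bounded_seq01 c01, bounded_seq01 e01).
rewrite (wsum_split N bc) (wsum_split N be).
rewrite (eq_bigr (fun i : 'I_N => b ^- i * e i)); last first.
  by move=> i _; rewrite ce.
rewrite opprD addrACA subrr add0r -mulrBr normrM gtr0_norm// ler_pM2l// -wsum1.
have h f : (forall n, 0 <= f n <= 1) -> 0 <= wsum b (fun n => f (n + N)%N) <= wsum b (fun=> 1).
  move=> f01; have bf := bounded_seq_shift N (bounded_seq01 f01).
  rewrite wsum_ge0//=; last by move=> n; have /andP[] := f01 (n + N)%N.
  apply: ler_wsum => //; last by move=> n; have /andP[] := f01 (n + N)%N.
  by apply: bounded_seq01 => n; rewrite lexx ler01.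
have /andP[? ?] := h _ c01; have /andP[? ?] := h _ e01.
by rewrite ler_norml; apply/andP; split; lra.
Qed.

Lemma nneseries_wsum c : bounded_seq c -> (forall n, 0 <= c n) ->
  (\sum_(0 <= n <oo) (b ^- n)%:E * (c n)%:E)%E = (wsum b c)%:E.
Proof.
move=> bc c0; apply: cvg_lim => //.
rewrite [X in X @ _](_ : _ = EFin \o series (fun n => b ^- n * c n)).
  by apply: cvg_EFin; [exact: nearW|exact: cvg_wsum].
apply/funext => n; rewrite /series /= -sumEFin.
by apply: eq_bigr => i _; rewrite EFinM.
Qed.

End weighted_sums.

(** * Uniqueness of an absolutely continuous invariant measure *)

Section invariant_measures.
Variable R : realType.

(* Let N be a negative set of m1 - m2 of minimal charge.  All T^-n N are negative
   sets of the same charge; so is their union U, and T^-1 U is included in U, so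
   the intersection of the T^-n U is strictly invariant with the charge of U. *)
Lemma invariant_measure_le d (X : measurableType d) (T : X -> X)
    (m1 m2 : {finite_measure set X -> \bar R}) :
  measurable_fun [set: X] T -> m1 [set: X] = m2 [set: X] ->
  (forall A, measurable A -> m1 (T @^-1` A) = m1 A) ->
  (forall A, measurable A -> m2 (T @^-1` A) = m2 A) ->
  (forall E, measurable E -> T @^-1` E = E ->
     (m1 E = 0 /\ m2 E = 0)%E \/ (m1 (~` E) = 0 /\ m2 (~` E) = 0)%E) ->
  forall A, measurable A -> (m2 A <= m1 A)%E.
Proof.
move=> mT m12 inv1 inv2 erg.
pose nu : {charge set X -> \bar R} := cadd (charge_of_finite_measure m1)
    (copp (charge_of_finite_measure m2)).
pose s A := fine (m1 A) - fine (m2 A).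
have nuE A : measurable A -> nu A = (s A)%:E.
  by move=> mA; rewrite /s EFinB !fineK ?fin_num_measure.
have sDI A B : measurable A -> measurable B -> s A = s (A `\` B) + s (A `&` B).
  move=> mA mB; have mD := measurableD mA mB; have mI := measurableI _ _ mA mB.
  by have := chargeDI nu mA mB; rewrite !nuE// => -[].
have mTn n A : measurable A -> measurable (iter n (fun B => T @^-1` B) A).
  move=> mA; elim: n => //= n IHn; rewrite -[_ @^-1` _]setTI; exact: mT.
have m1n n A : measurable A -> m1 (iter n (fun B => T @^-1` B) A) = m1 A.
  by move=> mA; elim: n => //= n IHn; rewrite inv1//; exact: mTn.
have m2n n A : measurable A -> m2 (iter n (fun B => T @^-1` B) A) = m2 A.
  by move=> mA; elim: n => //= n IHn; rewrite inv2//; exact: mTn.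
have [P [N [[mP posP] [mN negN] PN PIN]]] := Hahn_decomposition nu.
have s_ge A : measurable A -> A `<=` P -> 0 <= s A.
  by move=> mA AP; rewrite -lee_fin -nuE//; exact: posP.
have s_le A : measurable A -> A `<=` N -> s A <= 0.
  by move=> mA AN; rewrite -lee_fin -nuE//; exact: negN.
have minN A : measurable A -> s N <= s A.
  move=> mA; rewrite (sDI A N)// (sDI N A)// setIC lerD2r.
  rewrite (@le_trans _ _ 0)//.
    by apply: s_le; [exact: measurableD|exact: subDsetl].
  apply: s_ge; first exact: measurableD.
  by move=> x [_ Nx]; have [//|/Nx] : (P `|` N) x by rewrite PN.
(* Removing from [T^-n N] a part of positive charge would leave a set of charge below the minimum
   [s N]. *)
have negTN n : negative_set nu (iter n (fun B => T @^-1` B) N).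
  split; first exact: mTn.
  move=> A mA ATN; rewrite nuE// lee_fin.
  have := minN _ (measurableD (mTn n _ mN) mA).
  have : s (iter n (fun B => T @^-1` B) N) = s N by rewrite /s m1n// m2n.
  rewrite (sDI _ A)//; last exact: mTn.
  by rewrite (setIidr ATN); lra.
pose U := \bigcup_n iter n (fun B => T @^-1` B) N.
have [mU negU] : negative_set nu U by exact: bigcup_negative_set.
have UN : N `<=` U by move=> x Nx; exists 0%N.
have TU : T @^-1` U `<=` U by move=> x [n _ Ux]; exists n.+1.
pose E := \bigcap_n iter n (fun B => T @^-1` B) U.
have mE : measurable E by apply: bigcapT_measurable => n; exact: mTn.
have dec n : iter n.+1 (fun B => T @^-1` B) U `<=` iter n (fun B => T @^-1` B) U.
  by elim: n => //= n IHn; exact: preimage_subset.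
have TE : T @^-1` E = E.
  apply/seteqP; split => x Ex n _; last exact: (Ex n.+1).
  by apply: dec; exact: (Ex n).
have EU (m : {finite_measure set X -> \bar R}) :
    (forall n A, measurable A -> m (iter n (fun B => T @^-1` B) A) = m A) -> m E = m U.
  move=> mn; apply/esym.
  have : m \o (fun n => iter n (fun B => T @^-1` B) U) @ \oo --> m E.
    apply: nonincreasing_cvg_mu => //.
    - by rewrite /= -ge0_fin_numE// fin_num_measure.
    - by move=> n; exact: mTn.
    - apply/nonincreasing_seqP => n; apply/subsetPset; exact: dec.
  move=> /cvg_lim <- //; rewrite (_ : _ \o _ = cst (m U)) ?lim_cst//.
  by apply/funext => n /=; rewrite mn.
(* [E] is strictly invariant, so [E] or its complement is null for both measures; in the second case
   the equal total masses give [s E = 0]. *)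
have sU0 : s U = 0.
  rewrite /s -(EU _ m1n) -(EU _ m2n).
  have [[-> ->]|[m1E m2E]] := erg E mE TE; first by rewrite subrr.
  have mCE (m : {finite_measure set X -> \bar R}) : m (~` E) = 0%E -> m E = m setT.
    move=> mCE0; rewrite -(setUv E) measureU ?setICr//; last exact: measurableC.
    by rewrite [X in (_ + X)%E]mCE0 adde0.
  by rewrite (mCE _ m1E) (mCE _ m2E) m12 subrr.
move=> A mA.
(* It remains to chain [0 = s U <= s N <= s A]. *)
have := minN A mA.
have : s U <= s N.
  rewrite (sDI U N)// (setIidr UN) gerDr -lee_fin -nuE; last exact: measurableD.
  by apply: negU; [exact: measurableD|exact: subDsetl].
rewrite sU0 => h1 h2.
rewrite -[m1 A]fineK ?fin_num_measure// -[m2 A]fineK ?fin_num_measure//.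
by rewrite lee_fin -subr_ge0; exact: le_trans h2.
Qed.

(** Two applications of [invariant_measure_le] with the roles exchanged; restricting to the whole
    space with [mfrestr] supplies the finite-measure structure. *)
Lemma invariant_measure_unique d (X : measurableType d) (T : X -> X)
    (m1 m2 : {measure set X -> \bar R}) :
  measurable_fun [set: X] T -> (m1 [set: X] < +oo)%E -> m1 [set: X] = m2 [set: X] ->
  (forall A, measurable A -> m1 (T @^-1` A) = m1 A) ->
  (forall A, measurable A -> m2 (T @^-1` A) = m2 A) ->
  (forall E, measurable E -> T @^-1` E = E ->
     (m1 E = 0 /\ m2 E = 0)%E \/ (m1 (~` E) = 0 /\ m2 (~` E) = 0)%E) ->
  forall A, measurable A -> m1 A = m2 A.
Proof.
move=> mT m1oo m12 inv1 inv2 erg A mA.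
have restrT (m : {measure set X -> \bar R}) : (m [set: X] < +oo)%E ->
    exists n : {finite_measure set X -> \bar R}, forall B, n B = m B.
  by move=> moo; exists (mfrestr measurableT moo) => B; exact: (congr1 m (setIT B)).
have [n1 e1] := restrT m1 m1oo.
have [n2 e2] : exists n : {finite_measure set X -> \bar R}, forall B, n B = m2 B.
  by apply: restrT; rewrite -m12.
have i1 B : measurable B -> n1 (T @^-1` B) = n1 B by move=> mB; rewrite !e1 inv1.
have i2 B : measurable B -> n2 (T @^-1` B) = n2 B by move=> mB; rewrite !e2 inv2.
apply/eqP; rewrite eq_le -e1 -e2; apply/andP; split.
  apply: (invariant_measure_le mT) => //; first by rewrite e1 e2.
  by move=> E mE TE; rewrite !e1 !e2; have [[]|[]] := erg E mE TE; [left|right].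
apply: (invariant_measure_le mT) => //; first by rewrite e1 e2.
by move=> E mE TE; rewrite !e1 !e2; have [[]|[]] := erg E mE TE; [left|right].
Qed.

End invariant_measures.

(** * Parry's invariant measure *)

Section parry_measure.
Variable R : realType.
Local Notation leb := (@lebesgue_measure R).

(** Index 0 is the point 1 itself, which lies outside [[0, 1[] and is never visited again. *)
Definition beta_orbit (b : R) (n : nat) : R := iter n (beta_map b) 1.

Lemma beta_orbit_itv b n : 0 <= beta_orbit b n <= 1.
Proof.
case: n => [|n]; first by rewrite /beta_orbit /= ler01 lexx.
by have /andP[-> /ltW ->] := fpart_itv (b * beta_orbit b n).
Qed.

(* The norm only makes the weight nonnegative without any assumption on b. *)
Definition parry_measure (b : R) : {measure set (measurableTypeR R) -> \bar R} :=
  mseries (fun n : nat => (mscale (NngNum (normr_ge0 (b ^- n)))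
    (mrestr leb (measurable_itv `[0, beta_orbit b n[)) :
      {measure set (measurableTypeR R) -> \bar R})) 0%N.

Section parry.
Variable b : R.
Hypothesis b1 : 1 < b.

Let b0 : 0 < b. Proof. by rewrite (lt_trans _ b1). Qed.

Let len (A : set (measurableTypeR R)) n := fine (leb (A `&` `[0, beta_orbit b n[%classic)).

Let lenE A n : measurable A -> leb (A `&` `[0, beta_orbit b n[%classic) = (len A n)%:E.
Proof.
by move=> mA; rewrite fineK// lebesgue_Ico_fin_num//; have /andP[] := beta_orbit_itv b n.
Qed.

Let len01 A n : measurable A -> 0 <= len A n <= 1.
Proof.
move=> mA; have /andP[q0 q1] := beta_orbit_itv b n.
rewrite -!lee_fin -lenE// measure_ge0/=.
by rewrite (le_trans (lebesgue_Ico_le mA q0)).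
Qed.

Lemma parry_measureE (A : set (measurableTypeR R)) : measurable A ->
  parry_measure b A =
  (wsum b (fun n => fine (leb (A `&` `[0, beta_orbit b n[%classic))))%:E.
Proof.
move=> mA; rewrite -/(len A) -nneseries_wsum//; last by move=> n; have /andP[] := len01 n mA.
  rewrite /parry_measure/= /mseries; apply: eq_eseriesr => n _.
  transitivity (`|b ^- n|%:E * leb (A `&` `[0%R, beta_orbit b n[%classic))%E => //.
  rewrite lenE//; congr (_%:E * _)%E.
  by rewrite gtr0_norm// invr_gt0 exprn_gt0.
by apply: bounded_seq01 => n; exact: len01.
Qed.

(* Applying lebesgue_preimage_beta termwise shifts the series by one index; the
   lost term n = 0 is recovered because the digits floor (b * beta_orbit b n)
   are those of the expansion of 1 in base b. *)
Lemma parry_measure_invariant (A : set (measurableTypeR R)) : measurable A ->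
  parry_measure b (beta_map b @^-1` A) = parry_measure b A.
Proof.
move=> mA; have mTA := measurable_preimage_beta b mA.
rewrite !parry_measureE//; congr EFin; rewrite -/(len A) -/(len _).
(* With [q n] for [beta_orbit b n], the digit satisfies [floor (b * q n) / b = q n - b^-1 * q (n +
   1)]. *)
have lenT n : len (beta_map b @^-1` A) n =
    len A 0%N * (beta_orbit b n - b^-1 * beta_orbit b n.+1) + b^-1 * len A n.+1.
  have /andP[q0 _] := beta_orbit_itv b n.
  have := lebesgue_preimage_beta b0 q0 mA.
  rewrite lenE// (lenE 0%N)// (lenE n.+1)// -!EFinM -EFinD => -[->].
  congr (_ + _); rewrite mulrC; congr (_ * _).
  rewrite /beta_orbit iterS -/(beta_orbit b n) /beta_map /fpart mulrBr mulKf ?gt_eqF//.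
  by rewrite subKr mulrC.
have bo : bounded_seq (beta_orbit b) := bounded_seq01 (beta_orbit_itv b).
have bl : bounded_seq (len A) by apply: bounded_seq01 => n; exact: len01.
have bo1 := bounded_seq_shift 1 bo; have bl1 := bounded_seq_shift 1 bl.
have -> : len (beta_map b @^-1` A) =
  (len A 0%N \*o (beta_orbit b \+ ((- b^-1) \*o (fun n => beta_orbit b (n + 1)%N))))
  \+ (b^-1 \*o (fun n => len A (n + 1)%N)).
  by apply/funext => n; rewrite lenT /= addn1 mulNr.
have bo2 := bounded_seqZ (- b^-1) bo1.
rewrite wsumD//; [|exact/bounded_seqZ/bounded_seqD|exact: bounded_seqZ].
rewrite !wsumZ//; last exact: bounded_seqD.
(* The digit part is [len A 0] times a telescoping difference, of which only [beta_orbit b 0 = 1]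
   survives. *)
rewrite wsumD// wsumZ// (wsum_recl b1 bo) (wsum_recl b1 bl).
under [X in wsum b X]eq_fun do rewrite -addn1.
set w := wsum b _; set v := wsum b (fun n => len A n.+1).
have -> : wsum b (fun n => len A (n + 1)%N) = v.
  by congr wsum; apply/funext => n; rewrite addn1.
by rewrite mulNr addrK mulr1.
Qed.

End parry.

Section parry_unique.
Variables (b : R) (m : {measure set (measurableTypeR R) -> \bar R}).
Hypothesis b1 : 1 < b.

Lemma parry_measure_ac (A : set (measurableTypeR R)) : measurable A ->
  leb (A `&` `[0, 1[%classic) = 0%E -> parry_measure b A = 0%E.
Proof.
move=> mA A0; rewrite parry_measureE//.
rewrite [X in wsum b X](_ : _ = fun=> 0); first by rewrite wsum0.
apply/funext => n; rewrite (@subset_measure0 _ _ _ leb _ (A `&` `[0, 1[%classic))//.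
- by apply: measurableI.
- by apply: measurableI.
- apply: setIS => x /=; rewrite !in_itv/= => /andP[-> /lt_le_trans] -> //.
  by have /andP[] := beta_orbit_itv b n.
Qed.

(** Cross-multiplying by the total masses produces two invariant measures of equal total mass. By
    absolute continuity, the set that [beta_map_ergodic] shows to be Lebesgue-null is null for
    both. *)
Lemma parry_measure_unique : (m [set: R] < +oo)%E ->
  (forall A, measurable A -> m (beta_map b @^-1` A) = m A) ->
  (forall A : set (measurableTypeR R), measurable A -> leb (A `&` `[0, 1[%classic) = 0%E -> m A = 0%E) ->
  forall A, measurable A ->
    (m [set: R] * parry_measure b A = parry_measure b [set: R] * m A)%E.
Proof.
move=> moo minv mac.
have c0 : 0 <= fine (m [set: R]) by exact: fine_ge0.
have p0 : 0 <= fine (parry_measure b [set: R]) by exact: fine_ge0.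
have cE : (fine (m [set: R]))%:E = m [set: R] by rewrite fineK// ge0_fin_numE.
have pE : (fine (parry_measure b [set: R]))%:E = parry_measure b [set: R].
  by rewrite fineK// parry_measureE.
pose m1 : {measure set (measurableTypeR R) -> \bar R} :=
  mscale (NngNum c0) (parry_measure b).
pose m2 : {measure set (measurableTypeR R) -> \bar R} := mscale (NngNum p0) m.
have m1E A : m1 A = (m [set: R] * parry_measure b A)%E by rewrite -[in RHS]cE.
have m2E A : m2 A = (parry_measure b [set: R] * m A)%E by rewrite -[in RHS]pE.
have m1oo : (m1 [set: measurableTypeR R] < +oo)%E.
  by rewrite m1E -cE -pE -EFinM ltry.
have m2oo : (m2 [set: measurableTypeR R] < +oo)%E.
  by rewrite m2E -cE -pE -EFinM ltry.
move=> A mA; rewrite -m1E -m2E.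
apply: (@invariant_measure_unique R _ (measurableTypeR R) (beta_map b)) => //.
- exact: measurable_beta_map.
- by rewrite m1E m2E muleC.
- by move=> B mB; rewrite !m1E parry_measure_invariant.
- by move=> B mB; rewrite !m2E minv.
- move=> E mE TE; rewrite !m1E !m2E.
  have mCE := measurableC mE.
  have [E0|E0] := beta_map_ergodic b1 mE TE; [left|right];
    by rewrite (parry_measure_ac _ E0)// (mac _ _ E0)// !mule0.
Qed.

End parry_unique.

End parry_measure.

(** * Recovering the jumps of the Parry density *)

Section masses.
Variable R : realType.

Variables (a b : R).
Hypotheses (a1 : 1 < a) (b1 : 1 < b).

(* phi e x need not converge uniformly in x, but for each N the parameter e can be
   chosen such that the first N terms of both sums are already exact. *)
Lemma wsum_limit (k l e1 : R) (phi : R -> R -> R) (phi0 : R -> R) :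
  0 <= k -> 0 <= l -> 0 < e1 ->
  (forall e x : R, 0 < e <= e1 -> 0 <= x -> 0 <= phi e x <= 1) ->
  (forall x, 0 <= phi0 x <= 1) ->
  (forall x : R, 0 <= x -> exists2 e0 : R, 0 < e0 & forall e : R, 0 < e <= e0 -> phi e x = phi0 x) ->
  (forall e : R, 0 < e <= e1 -> k * wsum a (phi e \o beta_orbit a) =
                            l * wsum b (phi e \o beta_orbit b)) ->
  k * wsum a (phi0 \o beta_orbit a) = l * wsum b (phi0 \o beta_orbit b).
Proof.
move=> k0 l0 e10 phi01 phi001 phiE H.
have W0 (c : R) : 1 < c -> 0 <= c / (c - 1) by move=> c1; apply: divr_ge0; lra.
have orb0 (c : R) n : 0 <= beta_orbit c n by have /andP[] := beta_orbit_itv c n.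
have unif (c : R) N : exists2 e0 : R, 0 < e0 & forall (e : R) n, 0 < e <= e0 -> (n < N)%N ->
    phi e (beta_orbit c n) = phi0 (beta_orbit c n).
  elim: N => [|N [e0 e00 IHN]]; first by exists 1.
  have [e2 e20 h2] := phiE _ (orb0 c N).
  exists (Num.min e0 e2); first by rewrite lt_min e00.
  move=> e n; rewrite le_min => /and3P[ep ee0 ee2]; rewrite ltnS leq_eqVlt => /orP[/eqP ->|nN].
    by rewrite h2// ep.
  by rewrite IHN// ep.
apply/eqP; rewrite -subr_eq0 -normr_le0; apply/ler_addgt0Pr => /= d d0; rewrite add0r.
(* The tails cost at most [a ^- N * A] and [b ^- N * B], so powers below [d / (A + B + 1)] keep the
   total error below [d]; the summand 1 keeps the denominator positive. *)
set A := k * (a / (a - 1)); set B := l * (b / (b - 1)).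
have A0 : 0 <= A by apply: mulr_ge0 => //; exact: W0.
have B0 : 0 <= B by apply: mulr_ge0 => //; exact: W0.
have AB1 : 0 < A + B + 1 by lra.
have mono (c : R) M N : 1 < c -> (M <= N)%N -> c ^- N <= c ^- M.
  move=> c1 MN; have c0 : 0 < c by rewrite (lt_trans _ c1).
  by rewrite lef_pV2 ?posrE ?exprn_gt0// ler_eXn2l.
have [M Md] := inv_pow_small a1 (divr_gt0 d0 AB1).
have [K Kd] := inv_pow_small b1 (divr_gt0 d0 AB1).
pose N := maxn M K.
have Na : a ^- N < d / (A + B + 1) by apply: le_lt_trans Md; apply: mono => //; rewrite leq_maxl.
have Nb : b ^- N < d / (A + B + 1) by apply: le_lt_trans Kd; apply: mono => //; rewrite leq_maxr.
have [ea ea0 ha] := unif a N; have [eb eb0 hb] := unif b N.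
pose e := Num.min e1 (Num.min ea eb).
have e0 : 0 < e by rewrite !lt_min e10 ea0.
have [ee1 eea eeb] : [/\ e <= e1, e <= ea & e <= eb].
  by rewrite /e; split; rewrite ge_min ?lexx// ge_min lexx orbT// orbT.
have Ta : `|wsum a (phi e \o beta_orbit a) - wsum a (phi0 \o beta_orbit a)| <= a ^- N * (a / (a - 1)).
  apply: wsum_tail_le => // [n|n|n nN] /=; [by rewrite phi01// e0|exact: phi001|].
  by rewrite ha// e0.
have Tb : `|wsum b (phi e \o beta_orbit b) - wsum b (phi0 \o beta_orbit b)| <= b ^- N * (b / (b - 1)).
  apply: wsum_tail_le => // [n|n|n nN] /=; [by rewrite phi01// e0|exact: phi001|].
  by rewrite hb// e0.
have := H e; rewrite e0 ee1 => /(_ isT) He.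
set x := wsum a _ in Ta He *; set y := wsum a _ in Ta *.
set z := wsum b _ in Tb He *; set w := wsum b _ in Tb *.
have -> : k * y - l * w = l * (z - w) - k * (x - y) by rewrite !mulrBr He; ring.
apply: (le_trans (ler_normB _ _)); rewrite !normrM (ger0_norm k0) (ger0_norm l0).
have T1 := ler_wpM2l k0 Ta; have T2 := ler_wpM2l l0 Tb.
have T3 : a ^- N * A <= d / (A + B + 1) * A by rewrite ler_wpM2r// ltW.
have T4 : b ^- N * B <= d / (A + B + 1) * B by rewrite ler_wpM2r// ltW.
have T5 : d / (A + B + 1) * (A + B + 1) = d by rewrite mulfVK// gt_eqF.
have T6 : 0 < d / (A + B + 1) by rewrite divr_gt0.
move: T1 T2; rewrite [k * (_ * _)]mulrCA [l * (_ * _)]mulrCA -/A -/B => T1 T2.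
lra.
Qed.

(** For [t > 0] this is the size of the jump at [t] of the unnormalised Parry density. *)
Definition beta_mass (c t : R) := wsum c (fun n => (beta_orbit c n == t)%:R).

(** This is the limit at 0 from the right of the unnormalised Parry density, hence the sum of its
    jumps. *)
Definition beta_total_mass (c : R) := wsum c (fun n => (0 < beta_orbit c n)%R%:R).

Variables (k l : R).
Hypotheses (k0 : 0 <= k) (l0 : 0 <= l).
(** The sums are the integrals of the two Parry densities over [[0, t[], which meets [[0, x[] in
    length [Num.min t x]. *)
Hypothesis eq_parry : forall t : R, 0 <= t ->
  k * wsum a (fun n => Num.min t (beta_orbit a n)) =
  l * wsum b (fun n => Num.min t (beta_orbit b n)).

Let bounded_min (c t : R) : 0 <= t ->
  bounded_seq (fun n => Num.min t (beta_orbit c n)).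
Proof.
move=> t0; apply: bounded_seq01 => n; have /andP[q0 q1] := beta_orbit_itv c n.
by rewrite le_min t0 q0 ge_min q1 orbT.
Qed.

Lemma eq_beta_mass (t : R) : 0 < t -> k * beta_mass a t = l * beta_mass b t.
Proof.
move=> t0.
(* The second difference quotient of t |-> Num.min t x is the tent function of
   height 1 and half-width e around t. *)
pose tent (e x : R) :=
  2 / e * Num.min t x + (- e^-1 * Num.min (t + e) x + - e^-1 * Num.min (t - e) x).
have tentE (e x : R) : 0 < e -> tent e x =
    (2 * Num.min t x - Num.min (t + e) x - Num.min (t - e) x) / e.
  by move=> e0; rewrite /tent; field; rewrite gt_eqF.
apply: (@wsum_limit k l t tent (fun x => (x == t)%:R)) => //.
- move=> e x /andP[e0 et] x0; rewrite tentE// ler_pdivlMr// ler_pdivrMr// mul0r mul1r.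
  by case: (leP t x) => ?; case: (leP (t + e) x) => ?; case: (leP (t - e) x) => ?;
    apply/andP; split; lra.
- by move=> x; case: eqP => _; rewrite ?lexx ler01.
- move=> x x0; have [->|xt] := eqVneq x t.
    exists t => // e /andP[e0 et]; rewrite tentE//.
    have -> : Num.min (t + e) t = t by apply/min_idPr; lra.
    have -> : Num.min (t - e) t = t - e by apply/min_idPl; lra.
    rewrite minxx (_ : _ - _ = e) ?divff ?gt_eqF//; ring.
  (* For such [e] the points [t - e], [t], [t + e] lie on the same side of [x], where the minimum is
     affine and its second difference vanishes. *)
  exists `|x - t|; first by rewrite normr_gt0 subr_eq0.
  move=> e /andP[e0 ext]; rewrite tentE//.
  apply/eqP; rewrite mulf_eq0 invr_eq0 (gt_eqF e0) orbF; apply/eqP.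
  move: ext; rewrite ler_normr => /orP[] ext.
    by rewrite !(min_idPl _); lra.
  by rewrite !(min_idPr _); lra.
- move=> e /andP[e0 et].
  have te0 : 0 <= t - e by lra.
  have te1 : 0 <= t + e by lra.
  have t0' := ltW t0.
  have E (c : R) : 1 < c -> wsum c (tent e \o beta_orbit c) =
     2 / e * wsum c (fun n => Num.min t (beta_orbit c n)) +
     (- e^-1 * wsum c (fun n => Num.min (t + e) (beta_orbit c n)) +
      - e^-1 * wsum c (fun n => Num.min (t - e) (beta_orbit c n))).
    move=> c1; rewrite -!wsumZ//; try exact: bounded_min.
    rewrite -!wsumD//; first exact: bounded_seqZ (bounded_min c t0').
    + by apply: bounded_seqD; apply: bounded_seqZ; exact: bounded_min.
    + by apply: bounded_seqZ; exact: bounded_min.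
    + by apply: bounded_seqZ; exact: bounded_min.
  rewrite !E// !mulrDr !(mulrCA k) !(mulrCA l) !eq_parry//.
Qed.

(** The mean of the density over [[0, e[] tends to its right limit at 0: termwise,
    [e^-1 * Num.min e x] tends to the indicator of [0 < x]. *)
Lemma eq_beta_total_mass : k * beta_total_mass a = l * beta_total_mass b.
Proof.
apply: (@wsum_limit k l 1 (fun e x => e^-1 * Num.min e x) (fun x : R => (0 < x)%R%:R)) => //.
- move=> e x /andP[e0 _] x0; rewrite mulrC ler_pdivlMr// ler_pdivrMr// mul0r mul1r.
  by rewrite le_min (ltW e0) x0 ge_min lexx.
- by move=> x; case: ltP => _; rewrite ?lexx ler01.
- move=> x; rewrite le_eqVlt => /predU1P[<-|x0].
    by exists 1 => // e /andP[e0 _]; rewrite ltxx (min_idPr _) ?mulr0 ?ltW.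
  exists x => // e /andP[e0 ex].
  by rewrite x0 (min_idPl _)// mulVf// gt_eqF.
- move=> e /andP[e0 _].
  have E (c : R) : 1 < c -> wsum c ((fun x => e^-1 * Num.min e x) \o beta_orbit c) =
      e^-1 * wsum c (fun n => Num.min e (beta_orbit c n)).
    by move=> c1; rewrite -wsumZ//; exact: bounded_min (ltW e0).
  by rewrite !E// !(mulrCA k) !(mulrCA l) eq_parry// ltW.
Qed.

(** From index 1 on the orbit stays below 1. Through [eq_beta_mass] at [t = 1], this is what makes
    the scalars [k] and [l] equal. *)
Lemma beta_mass1 (c : R) : 1 < c -> beta_mass c 1 = 1.
Proof.
move=> c1; rewrite /beta_mass wsum_recl//; last first.
  by apply: bounded_seq01 => n; case: eqP => _; rewrite ?lexx ler01.
rewrite /beta_orbit/= eqxx (_ : (fun n => _) = fun=> 0) ?wsum0 ?mulr0 ?addr0//.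
apply/funext => n; rewrite lt_eqF//=.
by have /andP[] := fpart_itv (c * iter n (beta_map c) 1).
Qed.

End masses.

(** * The orbit of 1 *)

Section rigidity.
Variable R : realType.

Lemma bounded_seq_bool (p : nat -> bool) : bounded_seq (fun n => (p n)%:R : R).
Proof. by apply: bounded_seq01 => n; case: (p n); rewrite ?lexx ler01. Qed.
#[local] Hint Resolve bounded_seq_bool : core.

Section orbits.
Variable c : R.
Hypothesis c1 : 1 < c.

Lemma ler_wsum_bool (p q : nat -> bool) : (forall n, p n -> q n) ->
  wsum c (fun n => (p n)%:R) <= wsum c (fun n => (q n)%:R).
Proof.
move=> pq; apply: ler_wsum => // n.
by have := pq n; case: (p n) => [->//|_]; case: (q n); rewrite ?lexx ?ler01.
Qed.

Lemma wsum_pred1 i : wsum c (fun n => (n == i)%:R) = c ^- i.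
Proof.
rewrite (wsum_split c1 i.+1)// big_ord_recr/= eqxx mulr1 big1 ?add0r; last first.
  by move=> j _; rewrite ltn_eqF ?mulr0//.
rewrite (_ : (fun n => _) = fun=> 0) ?wsum0 ?mulr0 ?addr0//.
by apply/funext => n; rewrite gtn_eqF// addnS ltnS leq_addl.
Qed.

Lemma beta_orbitS n : beta_orbit c n.+1 = beta_map c (beta_orbit c n).
Proof. by []. Qed.

Lemma beta_orbitS_lt1 n : beta_orbit c n.+1 < 1.
Proof. by have /andP[] := fpart_itv (c * beta_orbit c n). Qed.

Lemma beta_orbitS_neq1 n : (1 == beta_orbit c n.+1) = false.
Proof. by rewrite gt_eqF// beta_orbitS_lt1. Qed.

Lemma beta_orbit_ge0 n : 0 <= beta_orbit c n.
Proof. by have /andP[] := beta_orbit_itv c n. Qed.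

Lemma beta_orbit_gt0 n : (0 < beta_orbit c n) = (beta_orbit c n != 0).
Proof. by rewrite lt_neqAle beta_orbit_ge0 andbT eq_sym. Qed.

Lemma beta_orbitD i j k : beta_orbit c i = beta_orbit c j ->
  beta_orbit c (k + i) = beta_orbit c (k + j).
Proof. by move=> ij; rewrite /beta_orbit !iterD -!/(beta_orbit c _) ij. Qed.

Lemma beta_map0 : beta_map c 0 = 0.
Proof. by rewrite /beta_map mulr0 fpart_id// lexx ltr01. Qed.

Lemma beta_orbit_eq0 i k : beta_orbit c i = 0 -> beta_orbit c (k + i) = 0.
Proof. by move=> i0; elim: k => // k IHk; rewrite addSn beta_orbitS IHk beta_map0. Qed.

Lemma beta_mass_gt0 n : 0 < beta_mass c (beta_orbit c n).
Proof.
apply: (@lt_le_trans _ _ (wsum c (fun k => (k == n)%:R))).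
  by rewrite wsum_pred1 invr_gt0 exprn_gt0// (lt_trans _ c1).
by apply: ler_wsum_bool => k /eqP ->.
Qed.

Lemma beta_mass_orbit t : 0 < beta_mass c t -> exists n, beta_orbit c n = t.
Proof.
move=> Mt; apply: contrapT => nt; move: Mt; rewrite /beta_mass.
rewrite (_ : (fun n => _) = fun=> 0) ?wsum0 ?ltxx//; apply/funext => n.
by case: eqP => // nt'; case: nt; exists n.
Qed.

Lemma beta_mass_uniq n : (forall k, beta_orbit c k = beta_orbit c n -> k = n) ->
  beta_mass c (beta_orbit c n) = c ^- n.
Proof.
move=> un; rewrite -wsum_pred1 /beta_mass; congr wsum; apply/funext => k.
by congr (_%:R); congr nat_of_bool; apply/eqP/eqP => [/un//|->].
Qed.

(** A repetition at indices [j < j'] before [m], pushed forward by [m - j'] steps, would bring the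
    orbit to 0 earlier than [m]. *)
Lemma beta_orbit_inj m i k : (forall n, (n < m)%N -> beta_orbit c n != 0) ->
  beta_orbit c m = 0 -> (i < m)%N -> beta_orbit c k = beta_orbit c i -> k = i.
Proof.
move=> nz m0 im ki.
have orb0 n : (m <= n)%N -> beta_orbit c n = 0.
  by move=> mn; rewrite -(subnK mn) beta_orbit_eq0.
have lt_absurd j j' : (j < j')%N -> (j' < m)%N -> beta_orbit c j = beta_orbit c j' -> False.
  move=> jj' jm E; have := beta_orbitD (m - j') E; rewrite subnK ?(ltnW jm)// m0.
  by move/eqP; apply/negP; apply: nz; lia.
case: (leqP m k) => [mk|km].
  by move: (nz _ im); rewrite -ki orb0// eqxx.
by case: (ltngtP k i) => // h; [case: (lt_absurd k i)|case: (lt_absurd i k)].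
Qed.

End orbits.

Lemma beta_orbit_rigidity (a b : R) : 1 < a -> a < b -> (forall i, a ^+ i != b) ->
  (forall t, 0 < t -> beta_mass a t = beta_mass b t) ->
  beta_total_mass a = beta_total_mass b ->
  (beta_orbit a 1 = 0 /\ beta_orbit b 1 = 0) \/
  (beta_orbit a 2 = 0 /\ beta_orbit a 1 = beta_orbit b 1).
Proof.
move=> a1 ab aXb Emass Etotal.
have b1 := lt_trans a1 ab.
have a0 : 0 < a by rewrite (lt_trans _ a1).
have b0 : 0 < b by rewrite (lt_trans _ b1).
have orb0 (c : R) : beta_orbit c 0 = 1 by [].
(* If the [a]-orbit avoided 0, its total mass would be [a / (a - 1)], which exceeds [b / (b - 1)],
   an upper bound for the total mass of [b]. *)
have /ex_minnP[m /eqP m0 mmin] : exists m, beta_orbit a m == 0.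
  apply: contrapT => /forallNP nz.
  have : beta_total_mass a <= wsum b (fun=> 1).
    by rewrite Etotal; apply: (ler_wsum_bool b1 (q := fun=> true)).
  rewrite (_ : beta_total_mass a = wsum a (fun=> 1)); last first.
    congr wsum; apply/funext => n; rewrite beta_orbit_gt0.
    by move/negP: (nz n) => ->.
  rewrite !wsum1// ler_pdivrMr ?subr_gt0// mulrAC ler_pdivlMr ?subr_gt0//.
  by lra.
have nz n : (n < m)%N -> beta_orbit a n != 0.
  by move=> nm; apply/negP => /mmin; rewrite leqNgt nm.
have m_gt0 : (0 < m)%N.
  by case: m m0 {mmin nz} => // /eqP; rewrite orb0 oner_eq0.
have mass_a i : (i < m)%N -> beta_mass a (beta_orbit a i) = a ^- i.
  move=> im; apply: beta_mass_uniq => // k; exact: beta_orbit_inj im.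
(* A positive point of the [b]-orbit has positive mass, so [Emass] places it on the [a]-orbit before
   0 is reached, where each mass is a single power. *)
have mass_b n : 0 < beta_orbit b n.+1 -> exists i, [/\ (0 < i)%N, (i < m)%N,
    beta_orbit a i = beta_orbit b n.+1 & beta_mass b (beta_orbit b n.+1) = a ^- i].
  move=> r0; have := beta_mass_gt0 b1 n.+1; rewrite -Emass// => Ma.
  have [i ir] := beta_mass_orbit Ma.
  have im : (i < m)%N.
    rewrite ltnNge; apply/negP => mi.
    by move: r0; rewrite -ir -(subnK mi) beta_orbit_eq0// ltxx.
  exists i; split => //; last by rewrite -ir mass_a.
  by case: i ir {im} => // /eqP; rewrite orb0 (beta_orbitS_neq1 b n).
(* These two lower bounds, from distinct indices before [m], turn a value of the total mass into a
   bound on [m]. *)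
have total_a2 i : (0 < i)%N -> (i < m)%N -> 1 + a ^- i <= beta_total_mass a.
  move=> i0 im; rewrite -[1]invr1 -[X in X^-1 + _](expr0 a) -!(wsum_pred1 a1) -wsumD//.
  apply: ler_wsum => // [|n]; first exact: bounded_seqD.
  rewrite /= -natrD ler_nat beta_orbit_gt0.
  have := nz n; case: (beta_orbit a n == 0); case: eqP => [->|]; case: eqP => //=; lia.
have total_a3 i j : (0 < i)%N -> (0 < j)%N -> (i < m)%N -> (j < m)%N -> i != j ->
    1 + a ^- i + a ^- j <= beta_total_mass a.
  move=> i0 j0 im jm ij.
  rewrite -[1]invr1 -[X in X^-1 + _ + _](expr0 a) -!(wsum_pred1 a1) -!wsumD//;
    last exact: bounded_seqD.
  apply: ler_wsum => // [|n]; first by apply: bounded_seqD => //; exact: bounded_seqD.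
  rewrite /= -!natrD ler_nat beta_orbit_gt0.
  have := nz n; case: (beta_orbit a n == 0); case: (n =P 0%N) => ?; case: (n =P i) => ?;
    case: (n =P j) => ?; case: eqP ij => //=; lia.
have [r10|r1nz] := eqVneq (beta_orbit b 1) 0.
  left; split=> //.
  have total_b : beta_total_mass b = 1.
    rewrite /beta_total_mass wsum_recl// orb0 ltr01.
    rewrite (_ : (fun n => _) = fun=> 0) ?wsum0 ?mulr0 ?addr0//.
    by apply/funext => n; rewrite -addn1 beta_orbit_eq0// ltxx.
  case: (ltngtP m 1) => [|m1|<-//]; first by rewrite ltnNge m_gt0.
  have := total_a2 1%N isT m1; rewrite Etotal total_b gerDl leNgt.
  by rewrite invr_gt0 exprn_gt0.
have r1 : 0 < beta_orbit b 1 by rewrite beta_orbit_gt0.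
have [i [i0 im ir Mi]] := mass_b 0%N r1.
right.
have [[p p0 /eqP rec]|norec] := pselect (exists2 p, (0 < p)%N & beta_orbit b p.+1 == beta_orbit b 1); last first.
  have : beta_mass b (beta_orbit b 1) = b ^- 1.
    apply: beta_mass_uniq => // -[|k] E.
      by move: (beta_orbitS_neq1 b 0); rewrite -E orb0 eqxx.
    by case: k E => // k E; case: norec; exists k.+1 => //; rewrite E.
  by rewrite Mi => /invr_inj/eqP; rewrite expr1 (negPf (aXb i)).
have [r21|r21] := eqVneq (beta_orbit b 2) (beta_orbit b 1).
  have rn n : beta_orbit b n.+1 = beta_orbit b 1.
    by elim: n => // n IHn; rewrite beta_orbitS IHn -beta_orbitS.
  have total_b : beta_total_mass b = 1 + a ^- i.
    rewrite -Mi /beta_total_mass /beta_mass [LHS]wsum_recl// [in RHS]wsum_recl//.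
    rewrite orb0 ltr01 (beta_orbitS_neq1 b 0) add0r; congr (_ + _ * wsum _ _).
    by apply/funext => n; rewrite !rn r1 eqxx.
  have m2 : (m <= 2)%N.
    rewrite leqNgt; apply/negP => m3.
    (* If [m >= 3], one of the indices 1 and 2 differs from [i] and would add a further positive
       term to the total mass. *)
    pose j := if i == 1%N then 2%N else 1%N.
    have [j0 jm ij] : [/\ (0 < j)%N, (j < m)%N & i != j].
      by rewrite /j; case: eqP => [->|/eqP]; split => //; lia.
    have := total_a3 i j i0 j0 im jm ij; rewrite Etotal total_b gerDl leNgt.
    by rewrite invr_gt0 exprn_gt0.
  have [i1 m2'] : i = 1%N /\ m = 2%N by lia.
  by split; [rewrite -m2'|rewrite -[in LHS]i1].
(* An orbit that has hit 0 could not return to the positive point [beta_orbit b 1]. *)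
have r2 : 0 < beta_orbit b 2.
  rewrite beta_orbit_gt0; apply/eqP => r20; move: r1.
  by rewrite -rec -(prednK p0) -addn2 beta_orbit_eq0// ltxx.
have [j [j0 jm jr Mj]] := mass_b 1%N r2.
(* The orbit is periodic from index 1 on, so the visits to [beta_orbit b 2] are exactly the
   successors of the visits to [beta_orbit b 1]. *)
have M21 : beta_mass b (beta_orbit b 2) = b^-1 * beta_mass b (beta_orbit b 1).
  rewrite {1}/beta_mass wsum_recl// orb0 (beta_orbitS_neq1 b 1) add0r.
  congr (_ * wsum _ _); apply/funext => n; congr (_%:R); congr nat_of_bool.
  apply/eqP/eqP => [|E]; last by rewrite beta_orbitS E.
  case: n => [E|n E]; first by case/eqP: r21.
  have := beta_orbitD p.-1 E; rewrite !addnS !addn0 -!addSn prednK//.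
  have := beta_orbitD n rec; rewrite !addnS addn0 => recn.
  by rewrite addSn (addnC p n) recn rec.
move: Mj; rewrite M21 Mi => /(congr1 (fun x => x^-1)); rewrite invfM !invrK => aj.
have ij : (i <= j)%N.
  rewrite leqNgt; apply/negP => ji; have : a ^+ j < b * a ^+ i.
    rewrite (@lt_trans _ _ (a ^+ i))// ?ltr_eXn2l// ltr_pMl// exprn_gt0//.
  by rewrite aj ltxx.
case/eqP: (aXb (j - i)%N); apply: (mulIf (lt0r_neq0 (exprn_gt0 i a0))).
by rewrite -exprD subnK.
Qed.

(** An irreducible rational polynomial that shares a real root with this monic quadratic is not
    coprime to it, hence divides it. *)
Lemma algebraic_degree_le2 (x : R) (d : nat) (n k l : int) :
  algebraic_degree x d -> (x - n%:~R) * (x - k%:~R) = l%:~R -> (d <= 2)%N.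
Proof.
move=> [p [_ [p1 irr_p] px] <-] xE.
pose q : {poly rat} := ('X - n%:~R%:P) * ('X - k%:~R%:P) - l%:~R%:P.
have sq : size q = 3%N.
  have sX : size (('X - n%:~R%:P) * ('X - k%:~R%:P) : {poly rat}) = 3%N.
    by rewrite size_mul ?polyXsubC_eq0// !size_XsubC.
  by rewrite /q size_polyDl ?sX// size_polyN (leq_ltn_trans (size_polyC_leq1 _)).
have q0 : q != 0 by rewrite -size_poly_eq0 sq.
have qx : root (map_poly ratr q) x.
  rewrite /q rmorphB rmorphM !rmorphB/= !map_polyX !map_polyC/= !ratr_int.
  by rewrite rootE !hornerE xE subrr.
have ncop : ~~ coprimep p q.
  apply/negP; rewrite -(coprimep_map (ratr : rat -> R)) => /coprimep_root /(_ px).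
  by move: qx; rewrite rootE => ->.
have /irr_p pg : size (gcdp p q) != 1%N by [].
have pq : p %| q.
  by rewrite -(eqp_dvdl _ (pg (dvdp_gcdl _ _))) dvdp_gcdr.
by have := dvdp_leq q0 pq; rewrite sq; case: (size p).
Qed.

(** If one number were the [i]-th power of the other, the quotient of logarithms would be [i] or its
    inverse. Both directions are kept because either number may be the smaller one. *)
Lemma multiplicatively_independent_expn (a b : R) : 1 < a -> 1 < b ->
  multiplicatively_independent a b -> forall i, a ^+ i != b /\ b ^+ i != a.
Proof.
move=> a1 b1 ab i.
have la : 0 < ln a by rewrite ln_gt0.
have lb : 0 < ln b by rewrite ln_gt0.
have lnX (c : R) : 1 < c -> ln (c ^+ i) = i%:R * ln c.
  by move=> c1; rewrite lnXn ?mulr_natl// (lt_trans _ c1).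
split; apply/eqP => E; apply: ab.
  have := lnX a a1; rewrite E => ->.
  exists (i%:R^-1) => //=; rewrite fmorphV/= rmorph_nat.
  by rewrite invfM mulrCA mulfV ?gt_eqF// mulr1.
have := lnX b b1; rewrite E => ->.
by exists (i%:R) => //=; rewrite rmorph_nat mulfK// gt_eqF.
Qed.

Lemma eq_beta_mass_quadratic (a b : R) : 1 < a -> a < b -> (forall i, a ^+ i != b) ->
  (forall t, 0 < t -> beta_mass a t = beta_mass b t) ->
  beta_total_mass a = beta_total_mass b ->
  (exists n k l : int, (a - n%:~R) * (a - k%:~R) = l%:~R) /\
  (exists n k l : int, (b - n%:~R) * (b - k%:~R) = l%:~R).
Proof.
move=> a1 ab aXb Em Et.
have orb1 (c : R) : beta_orbit c 1 = c - (Num.floor c)%:~R.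
  by rewrite beta_orbitS /beta_orbit/= /beta_map mulr1.
have [[]|[]] := beta_orbit_rigidity a1 ab aXb Em Et; rewrite !orb1.
  move=> a0 b0; split; [exists 0, (Num.floor a), 0|exists 0, (Num.floor b), 0];
    by rewrite ?a0 ?b0 mulr0.
rewrite beta_orbitS orb1 /beta_map /fpart => /eqP; rewrite subr_eq0 => /eqP E ab1.
set l := Num.floor (a * _) in E.
split; [exists 0, (Num.floor a), l|exists (Num.floor b - Num.floor a), (Num.floor b), l].
  by rewrite mulr0z subr0 E.
(* Equal fractional parts mean that [b - a] is the difference of the floors, so the equation of [a]
   becomes one for [b]. *)
rewrite -ab1 -E; congr (_ * _); rewrite intrB; lra.
Qed.

End rigidity.

(** * Ergodic decomposition of an ergodic measure *)

Section constant_kernel.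
Context d (X : measurableType d) (R : realType) (mu : probability X R) (T : X -> X).

(** The constant kernel works because an invariant [E] has measure 0 or 1, so the measure of the
    intersection of [A] and [E] is [mu A * mu E]. *)
Lemma ergodic_decomposition_cst : invariant_measure mu T -> ergodic_measure mu T ->
  exists2 k : R.-pker X ~> X, ergodic_decomposition mu T k &
    forall x, k x = mu :> {measure set X -> \bar R}.
Proof.
move=> inv erg.
pose P : X -> pprobability X R := fun=> mu.
have mP : measurable_fun [set: X] P by exact: measurable_cst.
exists (kprobability mP) => //; split => //.
- by apply: aeW.
- move=> A E mA mE TE; rewrite /kprobability/P/=.
  rewrite integral_cst//.
  have [E0|E1] := erg E mE TE.
    rewrite E0 mule0; apply: (@subset_measure0 _ _ _ mu _ E) => //.
    exact: measurableI.
  have CE : mu (~` E) = 0%E by rewrite probability_setC// E1 subee.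
  rewrite E1 mule1 [RHS](measureDI mu mA mE).
  rewrite (@subset_measure0 _ _ _ mu (A `\` E) (~` E)) ?add0e//.
  + exact: measurableD.
  + exact: measurableC.
Qed.

End constant_kernel.

(** * Transfer of measures from [[0, 1)] to the line *)

Section Ico01_pushforward.
Variables (R : realType) (mu : probability (Ico01 R) R).
Notation leb := (@lebesgue_measure R).

Lemma measurable_Ico01_val : measurable_fun [set: Ico01 R]
  (@Ico01_val R : Ico01 R -> measurableTypeR R).
Proof. by move=> _ B mB; rewrite setTI; exists B => //; rewrite setTI. Qed.

Lemma Ico01_val_image (B : set R) :
  @Ico01_val R @` (@Ico01_val R @^-1` B) = B `&` `[0, 1[%classic.
Proof.
apply/seteqP; split => [_ [x Bx <-]|x [Bx]].
  by split => //=; rewrite in_itv/=; exact: Ico01_valP.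
by rewrite /= in_itv/= => x01; exists (MkIco01 x01).
Qed.

Lemma Ico01_val_beta b (B : set R) :
  @Ico01_val R @^-1` (beta_map b @^-1` B) =
  beta_transformation b @^-1` (@Ico01_val R @^-1` B).
Proof. by []. Qed.

Lemma measurable_Ico01_preimage (B : set (measurableTypeR R)) : measurable B ->
  measurable (@Ico01_val R @^-1` B).
Proof. by move=> mB; rewrite -[_ @^-1` _]setTI; exact: measurable_Ico01_val. Qed.

(** The image of [mu] under the inclusion into the line is an absolutely continuous invariant
    probability, so [parry_measure_unique] applies. *)
Lemma renyi_parry_measureE b : 1 < b -> is_renyi_parry_measure b mu ->
  forall B, measurable (B : set (measurableTypeR R)) ->
  parry_measure b B = (parry_measure b [set: R] * mu (@Ico01_val R @^-1` B))%E.
Proof.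
move=> b1 [inv eqleb] B mB.
pose push : {measure set (measurableTypeR R) -> \bar R} :=
  pushforward mu (@Ico01_val R : Ico01 R -> measurableTypeR R).
pose m := push measurable_Ico01_val.
have mE A : m A = mu (@Ico01_val R @^-1` A) by [].
have mT : m [set: R] = 1%E by rewrite mE preimage_setT probability_setT.
rewrite -mE -(parry_measure_unique b1) ?mT ?mul1e ?ltry//.
- by move=> A mA; rewrite !mE Ico01_val_beta inv//; exact: measurable_Ico01_preimage.
- move=> A mA A0; rewrite mE; apply/eqleb; first exact: measurable_Ico01_preimage.
  by rewrite Ico01_val_image.
Qed.

(** The preceding identity is evaluated on [[0, t[]; the factor [wsum b (beta_orbit b)] is the total
    mass of the Parry measure. *)
Lemma renyi_parry_wsum (b t : R) : 1 < b -> 0 <= t -> is_renyi_parry_measure b mu ->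
  wsum b (fun n => Num.min t (beta_orbit b n)) =
  wsum b (beta_orbit b) * fine (mu (@Ico01_val R @^-1` `[0, t[%classic)).
Proof.
move=> b1 t0 rp.
have := renyi_parry_measureE b1 rp (measurable_itv `[0, t[).
rewrite !parry_measureE//.
have lebE s : 0 <= s -> fine (leb `[0, s[%classic) = s.
  move=> s0; rewrite lebesgue_measure_itv/= lte_fin.
  by case: ltgtP s0 => [_|_|<-] // _; rewrite ?oppr0 ?addr0.
rewrite -[mu _]fineK; last exact/fin_num_measure/measurable_Ico01_preimage.
rewrite -EFinM => -[E].
rewrite [X in wsum b X](_ : _ = fun n => fine (leb (`[0, t[%classic `&` `[0, beta_orbit b n[%classic))).
  rewrite E; congr (wsum b _ * _); apply/funext => n.
  by rewrite setTI lebE// beta_orbit_ge0.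
apply/funext => n; rewrite -[LHS]lebE; last by rewrite le_min t0 beta_orbit_ge0.
congr (fine (leb _)); apply/seteqP.
split => z; rewrite /= !in_itv/= lt_min; first by move=> /and3P[-> -> ->].
by move=> [/andP[-> ->] /andP[_ ->]].
Qed.

End Ico01_pushforward.

(** * Measures that are Renyi-Parry for two numbers *)

Lemma renyi_parry_quadratic (R : realType) (mu : probability (Ico01 R) R) (a b : R) :
  1 < a -> a < b -> (forall i, a ^+ i != b) ->
  is_renyi_parry_measure a mu -> is_renyi_parry_measure b mu ->
  (exists n k l : int, (a - n%:~R) * (a - k%:~R) = l%:~R) /\
  (exists n k l : int, (b - n%:~R) * (b - k%:~R) = l%:~R).
Proof.
move=> a1 ab aXb rpa rpb; have b1 := lt_trans a1 ab.
(* The total masses are taken crosswise, so that the common factor, the [mu]-measure of [[0, t[],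
   gives equal products in [eqp]. *)
pose k := wsum b (beta_orbit b); pose l := wsum a (beta_orbit a).
have C_gt0 c : 1 < c -> 0 < wsum c (beta_orbit c).
  move=> c1; have bo := bounded_seq01 (beta_orbit_itv c).
  rewrite wsum_recl// ltr_pwDl// ?ltr01// mulr_ge0 ?invr_ge0 ?(ltW (lt_trans ltr01 c1))//.
  apply: wsum_ge0 => // [|n]; last exact: beta_orbit_ge0.
  by apply: bounded_seq01 => n; exact: (beta_orbit_itv c n.+1).
have k0 : 0 < k by exact: C_gt0.
have l0 : 0 < l by exact: C_gt0.
have eqp t : 0 <= t -> k * wsum a (fun n => Num.min t (beta_orbit a n)) =
                       l * wsum b (fun n => Num.min t (beta_orbit b n)).
  by move=> t0; rewrite (renyi_parry_wsum a1 t0 rpa) (renyi_parry_wsum b1 t0 rpb) mulrCA.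
have kl : k = l.
  have := eq_beta_mass a1 b1 (ltW k0) (ltW l0) eqp ltr01.
  by rewrite !beta_mass1// !mulr1.
apply: eq_beta_mass_quadratic => //.
  move=> t t0; have := eq_beta_mass a1 b1 (ltW k0) (ltW l0) eqp t0.
  by rewrite kl => /mulfI; apply; rewrite gt_eqF.
have := eq_beta_total_mass a1 b1 (ltW k0) (ltW l0) eqp.
by rewrite kl => /mulfI; apply; rewrite gt_eqF.
Qed.

Theorem corollary1p2 (R : realType)
    (hochman_shmerkin : hochman_shmerkin_corollary R)
    (beta1 beta2 : R) (degree1 : nat)
    (beta1_pisot : pisot beta1)
    (beta1_degree : algebraic_degree beta1 degree1)
    (degree1_ge3 : (3 <= degree1)%N)
    (beta2_gt1 : 1 < beta2)
    (beta12_indep : multiplicatively_independent beta1 beta2) :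
  ~ exists mu : probability (Ico01 R) R,
      [/\ invariant_measure mu (beta_transformation beta1),
          invariant_measure mu (beta_transformation beta2),
          ergodic_measure mu (beta_transformation beta2)
        & (0 < ks_entropy mu (beta_transformation beta2))%E].
Proof.
move=> [mu [inv1 inv2 erg ent]].
have [k dec kE] := ergodic_decomposition_cst inv2 erg.
have beta1_gt1 : 1 < beta1 by case: beta1_pisot.
have ent' : {ae mu, forall x, (0 < ks_entropy (k x) (beta_transformation beta2))%E}.
  by apply: aeW => x; rewrite kE.
have [rp1 rp2] := hochman_shmerkin _ _ beta1_pisot beta2_gt1 beta12_indep _ inv1 inv2 _ dec ent'.
have indep := multiplicatively_independent_expn beta1_gt1 beta2_gt1 beta12_indep.
suff [n [m [l E]]] : exists n m l : int, (beta1 - n%:~R) * (beta1 - m%:~R) = l%:~R.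
  by have := algebraic_degree_le2 beta1_degree E; rewrite leqNgt degree1_ge3.
(* The smaller number must come first, and either one may be [beta1]; equality is excluded as the
   power with exponent 1. *)
case: (ltgtP beta1 beta2) => [lt12|lt21|eq12].
- by case: (renyi_parry_quadratic beta1_gt1 lt12 _ rp1 rp2) => // i; case: (indep i).
- by case: (renyi_parry_quadratic beta2_gt1 lt21 _ rp2 rp1) => // i; case: (indep i).
- by have [] := indep 1%N; rewrite expr1 eq12 eqxx.
Qed.
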